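(* Let $\mathfrak N_K$ be the set of all $K$-user discrete memoryless broadcast channels, and for $\mathcal N\in\mathfrak N_K$ let $C_\Sigma^{\mathrm{NS}}(\mathcal N)$ and $C_\Sigma(\mathcal N)$ be its sum-capacity with and without NS-assistance. Then $$\sup_{\mathcal N\in\mathfrak N_K}\frac{C_\Sigma^{\mathrm{NS}}(\mathcal N)}{C_\Sigma(\mathcal N)}=K.$$
   Context: Coding framework for a discrete memoryless $K$-user BC $\mathcal N(y_1,\dots,y_K\mid x)$: independent messages $W_k$ uniform on finite nonempty $\mathcal M_k$. Classical scheme: stochastic encoder $X^{[n]}=\phi(W_1,\dots,W_K)$, stochastic decoders $\hat W_k=\psi_k(Y_k^{[n]})$. A $\kappa$-partite NS box is a conditional pmf $\mathcal Z(b_{[\kappa]}\mid a_{[\kappa]})$ (finite output alphabets) such that for every subset of parties, the marginal of their outputs depends only on their own inputs. NS-assisted scheme: a $(K+1)$-partite NS box where the transmitter inputs $(W_1,\dots,W_K)$ and obtains output $U$ sent as $X^{[n]}$, and Rx-$k$ inputs $Y_k^{[n]}$ and obtains $\hat W_k$; joint law $\frac{1}{\prod_k|\mathcal M_k|}\mathcal Z(x^{[n]},\hat w\mid w,y^{[n]})\mathcal N^{\otimes n}(y^{[n]}\mid x^{[n]})$. A rate tuple is achievable if some sequence of schemes has $\max_k\Pr(\hat W_k\ne W_k)\to0$ and $\lim_n\frac1n\log_2|\mathcal M_k^{(n)}|\ge R_k$; capacity region = closure; sum-capacity = max of $\sum_kR_k$ over it. *)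

(* Defs.v *)
From HB Require Import structures.
From mathcomp Require Import all_boot all_order all_algebra.
From mathcomp Require Import all_classical all_reals all_analysis.
Set Implicit Arguments. Unset Strict Implicit. Unset Printing Implicit Defensive.
Import Order.TTheory GRing.Theory Num.Theory.
Import numFieldNormedType.Exports.
Local Open Scope classical_set_scope.
Local Open Scope ring_scope.

Section BC.
Variable R : realType.

Definition cond_pmf (A B : finType) (W : A -> B -> R) : Prop :=
  forall a, (forall b, 0 <= W a b) /\ \sum_(b : B) W a b = 1.

Definition joint_out (K : nat) (Y : 'I_K -> finType) : finType :=
  {dffun forall k : 'I_K, Y k}.

Definition is_BC (K : nat) (X : finType) (Y : 'I_K -> finType)
  (N : X -> joint_out Y -> R) : Prop := cond_pmf N.

Definition msgs (K : nat) (m : 'I_K -> nat) : finType :=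
  {dffun forall k : 'I_K, 'I_(m k)}.

Definition Xn (X : finType) (n : nat) : finType := {ffun 'I_n -> X}.
Definition Ykn (K : nat) (Y : 'I_K -> finType) (n : nat) (k : 'I_K) : finType :=
  {ffun 'I_n -> Y k}.
Definition Yn (K : nat) (Y : 'I_K -> finType) (n : nat) : finType :=
  {ffun 'I_n -> joint_out Y}.

Definition chan_n (K : nat) (X : finType) (Y : 'I_K -> finType)
  (N : X -> joint_out Y -> R) (n : nat) (x : Xn X n) (y : Yn Y n) : R :=
  \prod_(t < n) N (x t) (y t).

Definition proj_rx (K : nat) (Y : 'I_K -> finType) (n : nat) (y : Yn Y n)
  (k : 'I_K) : Ykn Y n k := [ffun t => y t k].

Definition all_rx (K : nat) (Y : 'I_K -> finType) (n : nat) (y : Yn Y n) :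
  {dffun forall k : 'I_K, Ykn Y n k} := [ffun k => proj_rx y k].

(* Pr(hat W_k <> W_k) for a joint law J(w, x^n, y^n, hat w) (which already
   contains the channel law), messages uniform *)
Definition err_prob (K : nat) (X : finType) (Y : 'I_K -> finType) (n : nat)
  (m : 'I_K -> nat) (J : msgs m -> Xn X n -> Yn Y n -> msgs m -> R)
  (k : 'I_K) : R :=
  (\prod_(i < K) (m i)%:R)^-1 *
  \sum_(w : msgs m) \sum_(x : Xn X n) \sum_(y : Yn Y n)
     \sum_(wh : msgs m | wh k != w k) J w x y wh.

Definition max_err (K : nat) (X : finType) (Y : 'I_K -> finType) (n : nat)
  (m : 'I_K -> nat) (J : msgs m -> Xn X n -> Yn Y n -> msgs m -> R) : R :=
  \big[Num.max/0]_(k < K) err_prob J k.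

Record classical_scheme (K : nat) (X : finType) (Y : 'I_K -> finType)
    (n : nat) (m : 'I_K -> nat) := ClassicalScheme {
  enc : msgs m -> Xn X n -> R;
  dec : forall k : 'I_K, Ykn Y n k -> 'I_(m k) -> R;
  enc_pmf : cond_pmf enc;
  dec_pmf : forall k : 'I_K, @cond_pmf (Ykn Y n k) (ordinal (m k)) (@dec k) }.

Arguments dec [K X Y n m] c k _ _.

Definition classical_law (K : nat) (X : finType) (Y : 'I_K -> finType)
  (N : X -> joint_out Y -> R) (n : nat) (m : 'I_K -> nat)
  (S : classical_scheme X Y n m) :
  msgs m -> Xn X n -> Yn Y n -> msgs m -> R :=
  fun w x y wh => enc S w x * chan_n N x y *
                  \prod_(k < K) dec S k (proj_rx y k) (wh k).

(* (K+1)-partite non-signaling box: party "Tx" has input w (messages) and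
   output x^n; party "Rx k" has input y_k^n and output hat w_k.
   Z((x, hat w) | (w, (y_k)_k)).  No-signaling: for every subset of parties,
   given by (tx : bool) = whether Tx is in the subset and T = receivers in
   the subset, the marginal of their outputs depends only on their inputs. *)
Definition rx_in (K : nat) (Y : 'I_K -> finType) (n : nat) : finType :=
  {dffun forall k : 'I_K, Ykn Y n k}.

Definition NS_box (K : nat) (X : finType) (Y : 'I_K -> finType) (n : nat)
  (m : 'I_K -> nat) (Z : msgs m * rx_in Y n -> Xn X n * msgs m -> R) : Prop :=
  (forall a, (forall b, 0 <= Z a b) /\ \sum_b Z a b = 1) /\
  forall (tx : bool) (T : {set 'I_K}) (w w' : msgs m) (y y' : rx_in Y n)
         (x : Xn X n) (wh : msgs m),
    (tx -> w = w') -> (forall k, k \in T -> y k = y' k) ->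
    \sum_(b : Xn X n * msgs m |
            ((tx ==> (b.1 == x)) && [forall k in T, b.2 k == wh k]))
       Z (w, y) b =
    \sum_(b : Xn X n * msgs m |
            ((tx ==> (b.1 == x)) && [forall k in T, b.2 k == wh k]))
       Z (w', y') b.

Definition NS_law (K : nat) (X : finType) (Y : 'I_K -> finType)
  (N : X -> joint_out Y -> R) (n : nat) (m : 'I_K -> nat)
  (Z : msgs m * rx_in Y n -> Xn X n * msgs m -> R) :
  msgs m -> Xn X n -> Yn Y n -> msgs m -> R :=
  fun w x y wh => Z (w, all_rx y) (x, wh) * chan_n N x y.

Definition log2 (x : R) : R := ln x / ln 2.

Definition rates_ok (K : nat) (ms : nat -> 'I_K -> nat) (r : 'I_K -> R) :=
  forall k, exists l : R,
    (fun n : nat => n%:R^-1 * log2 (ms n k)%:R) @ \oo --> l /\ r k <= l.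

Definition achievable (K : nat) (X : finType) (Y : 'I_K -> finType)
  (N : X -> joint_out Y -> R) (r : 'I_K -> R) : Prop :=
  exists (ms : nat -> 'I_K -> nat)
         (S : forall n, classical_scheme X Y n (ms n)),
    (forall n k, (0 < ms n k)%N) /\
    (fun n => max_err (classical_law N (S n))) @ \oo --> 0 /\
    rates_ok ms r.

Definition NS_achievable (K : nat) (X : finType) (Y : 'I_K -> finType)
  (N : X -> joint_out Y -> R) (r : 'I_K -> R) : Prop :=
  exists (ms : nat -> 'I_K -> nat)
         (Z : forall n, msgs (ms n) * rx_in Y n -> Xn X n * msgs (ms n) -> R),
    (forall n k, (0 < ms n k)%N) /\
    (forall n, NS_box (Z n)) /\
    (fun n => max_err (NS_law N (Z n))) @ \oo --> 0 /\
    rates_ok ms r.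

(* sum-capacity = sup of R_1+..+R_K over (nonnegative) achievable tuples
   (= max over the closure, the capacity region) *)
Definition sum_capacity (K : nat) (X : finType) (Y : 'I_K -> finType)
  (N : X -> joint_out Y -> R) : \bar R :=
  ereal_sup [set (\sum_(k < K) r k)%:E | r in
              [set r : 'I_K -> R | (forall k, 0 <= r k) /\ achievable N r]].

Definition NS_sum_capacity (K : nat) (X : finType) (Y : 'I_K -> finType)
  (N : X -> joint_out Y -> R) : \bar R :=
  ereal_sup [set (\sum_(k < K) r k)%:E | r in
              [set r : 'I_K -> R | (forall k, 0 <= r k) /\ NS_achievable N r]].

Definition NS_gain_ratios (K : nat) : set (\bar R) :=
  [set z | exists (X : finType) (Y : 'I_K -> finType)
                  (N : X -> joint_out Y -> R),
     is_BC N /\ (0 < sum_capacity N)%E /\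
     z = (NS_sum_capacity N / sum_capacity N)%E].

End BC.

(* Main.v *)
Require Import Defs.
From HB Require Import structures.
From mathcomp Require Import all_boot all_order all_algebra.
From mathcomp Require Import all_classical all_reals all_analysis.
From mathcomp Require Import ring lra.
Set Implicit Arguments. Unset Strict Implicit. Unset Printing Implicit Defensive.
Import Order.TTheory GRing.Theory Num.Theory.
Import numFieldNormedType.Exports.
Local Open Scope ring_scope.

(** Upper bound: a non-signaling box serving receiver [k] alone can be rounded.
    Its input/output law defines a codeword distribution and acceptance
    probabilities, and random coding with [M/n] of the [M] messages turns its
    success probability [S] into at least [S (1 - 1/n)]; no information measure is
    needed. Hence each rate of an NS-achievable tuple is classically achievable by
    its receiver alone, and the NS sum rate is at most [K] times the classical one.

    Lower bound: the input is a polynomial [x] of degree [< K] over a field of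
    size [q]; receiver [k] sees [x] at a random point of its own set [A_k], where
    the [A_k] are disjoint of size about [q/K]. The box outputs a uniform [x] and
    lets receiver [k] recover [w_k = y_k + (w_k - x(a_k))]; interpolation makes it
    non-signaling, so all [K] users get rate [log q] without error. Classically, a
    receiver separates codewords almost as well as any other one: among codewords
    that the remaining receivers can decode, the number of those confused with a
    given one is at most exponential in [n] with a base bounded in terms of [K]
    only. The classical sum-capacity is thus [log q + O_K(1)], and [q] tends to
    infinity. *)

(** * Sums over dependent products, independence and averaging *)

Section SumsOverProducts.
Variable R : realType.

(** Generalized distributivity for families whose factors have different types; the sum is
    transported along the bijection with [fprod], where it becomes a sum over tagged functions. *)
Lemma sum_dffun_prod (I : finType) (T : I -> finType) (F : forall i, T i -> R) :
  \sum_(f : {dffun forall i, T i}) \prod_i F i (f i) =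
  \prod_i \sum_(j : T i) F i j.
Proof.
rewrite (reindex (@dffun_of_fprod I T)); last exact/onW_bij/dffun_of_fprod_bij.
under eq_bigr => t _.
  under eq_bigr => i _.
    rewrite ffunE (_ : F i (t i) = [ffun j => F i j] (t i)); last by rewrite ffunE.
    over.
  over.
rewrite (big_fprod _ _ (fun i => [ffun j => F i j])).
under [RHS]eq_bigr => i _.
  rewrite (big_tag (fun i j => F i j) i) big_mkcond /=.
  rewrite -big_mkcond /=.
  over.
rewrite bigA_distr_big_dep; apply: eq_bigr => g _; apply: eq_bigr => i _.
by rewrite /untag; case: eqP => // e; rewrite ffunE.
Qed.

(** Absorb [g] into the factor [k], which [dfwith] overrides; every other factor sums to one. *)
Lemma sum_dffun_marginal (I : finType) (T : I -> finType)
    (F : forall i, T i -> R) (k : I) (g : T k -> R) :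
  (forall i, \sum_j F i j = 1) ->
  \sum_(f : {dffun forall i, T i}) (\prod_i F i (f i)) * g (f k) =
  \sum_j F k j * g j.
Proof.
move=> F1; pose G := dfwith F k (fun j => F k j * g j).
have Gk : G k = (fun j => F k j * g j) by exact: dfwithin.
have Gi i : i != k -> G i = F i by move=> ik; apply: dfwithout; rewrite eq_sym.
rewrite (eq_bigr (fun f : {dffun forall i, T i} => \prod_i G i (f i))).
  rewrite sum_dffun_prod (bigD1 k) //= [X in _ * X]big1 ?mulr1 ?Gk // => i ik.
  by rewrite Gi.
move=> f _; rewrite (bigD1 k) //= [RHS](bigD1 k) //= Gk mulrAC.
congr (_ * _); apply: eq_bigr => i ik.
by rewrite Gi.
Qed.

Lemma expectation1 (I X : finType) (p g : X -> R) (i : I) :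
  \sum_x p x = 1 ->
  \sum_(c : {ffun I -> X}) (\prod_l p (c l)) * g (c i) = \sum_x p x * g x.
Proof. by move=> p1; rewrite (@sum_dffun_marginal I (fun=> X) (fun=> p)). Qed.

Lemma expectation2 (I X : finType) (p g h : X -> R) (i j : I) :
  i != j -> \sum_x p x = 1 ->
  \sum_(c : {ffun I -> X}) (\prod_l p (c l)) * (g (c i) * h (c j)) =
  (\sum_x p x * g x) * (\sum_x p x * h x).
Proof.
move=> ij p1.
pose G l x := p x * (if l == i then g x else 1) * (if l == j then h x else 1).
rewrite (eq_bigr (fun c : {ffun I -> X} => \prod_l G l (c l))).
  rewrite -(bigA_distr_bigA G) (bigD1 i) //= (bigD1 j) 1?eq_sym //= mulrA.
  rewrite [X in _ * X]big1 ?mulr1 => [|l /andP[/negPf li /negPf lj]].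
    congr (_ * _); apply: eq_bigr => x _; rewrite /G eqxx.
      by rewrite (negPf ij) mulr1.
    by rewrite eq_sym (negPf ij) mulr1.
  by rewrite -p1; apply: eq_bigr => x _; rewrite /G li lj !mulr1.
move=> c _; rewrite /G !big_split /= -mulrA; congr (_ * (_ * _)).
  by rewrite -big_mkcond big_pred1_eq.
by rewrite -big_mkcond big_pred1_eq.
Qed.

Lemma sum_indicator (T : finType) (P : pred T) (F : T -> R) :
  \sum_(x | P x) F x = \sum_x F x * (P x)%:R.
Proof.
by rewrite big_mkcond; apply: eq_bigr => x _; case: (P x); rewrite ?mulr1 ?mulr0.
Qed.

(** Otherwise all gaps [v - V s] are positive while their [p]-weighted sum is zero, which is
    impossible since some [p t] is positive. *)
Lemma exists_ge_average (T : finType) (p V : T -> R) :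
  (forall t, 0 <= p t) -> \sum_t p t = 1 ->
  exists t, \sum_t p t * V t <= V t.
Proof.
move=> p0 p1; apply: contrapT => /forallNP noV; set v := \sum_t _ in noV *.
have lt t : V t < v by rewrite ltNge; apply/negP/noV.
have [t pt] : exists t, 0 < p t.
  apply: contrapT => /forallNP np; have := oner_neq0 R.
  rewrite -p1 big1 ?eqxx // => t _; apply/eqP; rewrite eq_le p0 andbT leNgt.
  exact/negP/np.
have s0 : \sum_s p s * (v - V s) = 0.
  under eq_bigr do rewrite mulrBr.
  by rewrite sumrB -mulr_suml p1 mul1r subrr.
have := psumr_eq0P (fun s _ => mulr_ge0 (p0 s) _) s0.
move=> /(_ _ t isT)/eqP; rewrite mulf_eq0 (gt_eqF pt) subr_eq0 (gt_eqF (lt t)).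
by move=> H; suff: false by []; apply: H => s; rewrite subr_ge0 ltW.
Qed.

Lemma exists_le_average (T : finType) (p V : T -> R) :
  (forall t, 0 <= p t) -> \sum_t p t = 1 ->
  exists t, V t <= \sum_t p t * V t.
Proof.
move=> p0 p1; have [t] := exists_ge_average (fun t => - V t) p0 p1.
under eq_bigr do rewrite mulrN.
by rewrite sumrN lerN2; exists t.
Qed.

End SumsOverProducts.

(** * Random coding from acceptance probabilities *)

Section RandomCoding.
Variable R : realType.

(** Choose [i] with probability proportional to [a i y], uniformly if all vanish. With [u] the total
    weight of the competitors, the normalizer is at most [1 + u], and [1 / (1 + u) >= 1 - u]. *)
Lemma threshold_decoder (Y : finType) (L : nat) (a : 'I_L.+1 -> Y -> R) :
  (forall i y, 0 <= a i y <= 1) ->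
  exists D : Y -> 'I_L.+1 -> R, cond_pmf D /\
    forall y i, a i y * (1 - \sum_(j | j != i) a j y) <= D y i.
Proof.
move=> a01; pose t y := \sum_i a i y.
have a0 i y : 0 <= a i y by case/andP: (a01 i y).
have t0 y : 0 <= t y by apply: sumr_ge0.
exists (fun y i => if t y == 0 then L.+1%:R^-1 else a i y / t y); split.
  move=> y /=; case: (eqVneq (t y) 0) => ty; split.
  - by move=> i; rewrite invr_ge0.
  - by rewrite sumr_const card_ord -[LHS]mulr_natr mulVf ?pnatr_eq0.
  - by move=> i; rewrite divr_ge0.
  - by rewrite -mulr_suml mulfV.
move=> y i /=; case: (eqVneq (t y) 0) => ty.
  have : a i y = 0 by have /(_ i isT) := psumr_eq0P (fun i _ => a0 i y) ty.
  by move=> ->; rewrite mul0r invr_ge0.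
rewrite -subr_ge0 -mulrBr mulr_ge0 //.
set u := \sum_(_ | _) _.
have tE : t y = a i y + u by rewrite /t (bigD1 i).
have u0 : 0 <= u by apply: sumr_ge0.
have tp : 0 < t y by rewrite lt_neqAle eq_sym ty t0.
have ti : t y <= 1 + u by rewrite tE lerD2r; case/andP: (a01 i y).
rewrite subr_ge0 -(ler_pM2r tp) mulVf ?gt_eqF // mulrC.
case: (lerP u 1) => u1.
  apply: (@le_trans _ _ ((1 + u) * (1 - u))).
    by apply: ler_wpM2r => //; rewrite subr_ge0.
  by have := sqr_ge0 u; nra.
nra.
Qed.

(* r x y is the probability that the box outputs x at the sender and the right
   message at a receiver observing y. A codeword x drawn from p is accepted on y
   with probability r x y / p x, so that each codeword is accepted with
   probability 1/M, independently of the others. *)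
Lemma random_codebook (X Y : finType) (W : X -> Y -> R) (p : X -> R)
    (r : X -> Y -> R) (M : R) (L : nat) :
  (0 < L)%N ->
  (forall x y, 0 <= W x y) -> (forall x, 0 <= p x) -> \sum_x p x = 1 ->
  (forall x y, 0 <= r x y <= p x) -> (forall y, \sum_x r x y = M^-1) ->
  exists (c : 'I_L -> X) (D : Y -> 'I_L -> R), cond_pmf D /\
    (\sum_y \sum_x W x y * r x y) * (1 - L.-1%:R / M) <=
    L%:R^-1 * \sum_i \sum_y W (c i) y * D y i.
Proof.
case: L => // L _ W0 p0 p1 rp rM.
pose a x y := r x y / p x.
(* Where [p x] vanishes so does [r x y], so division by zero does no harm. *)
have pa x y : p x * a x y = r x y.
  rewrite /a mulrCA; case: (eqVneq (p x) 0) => [px|px]; last by rewrite divff ?mulr1.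
  have := rp x y; rewrite px mul0r mulr0 => /andP[r0 r1].
  by apply/eqP; rewrite eq_le r0 r1.
have a01 x y : 0 <= a x y <= 1.
  case/andP: (rp x y) => r0 r1; rewrite divr_ge0 //=.
  case: (eqVneq (p x) 0) => [px|px]; first by rewrite /a px invr0 mulr0.
  by rewrite ler_pdivrMr ?mul1r // lt_neqAle eq_sym px p0.
have [D DP] := choice (fun c : {ffun 'I_L.+1 -> X} =>
  threshold_decoder (fun i => a01 (c i))).
pose P (c : {ffun 'I_L.+1 -> X}) := \prod_l p (c l).
have P0 c : 0 <= P c by apply: prodr_ge0.
have P1 : \sum_c P c = 1.
  by rewrite -(bigA_distr_bigA (fun _ => p)) big1 // => i _; exact: p1.
pose V (c : {ffun 'I_L.+1 -> X}) := L.+1%:R^-1 * \sum_i \sum_y W (c i) y * D c y i.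
have [c cP] := exists_ge_average V P0 P1.
exists c, (D c); split; first by case: (DP c).
apply: le_trans cP; rewrite /V.
under [leRHS]eq_bigr do rewrite mulrCA mulr_sumr.
rewrite -mulr_sumr [X in _ <= _ * X]exchange_big /=.
rewrite [leRHS]mulrC ler_pdivlMr ?ltr0n //.
(* Writing the left side as [L.+1] equal terms reduces the claim to one codeword [i]. *)
set s := (X in X * L.+1%:R); rewrite (_ : s * _ = \sum_(i < L.+1) s); last first.
  by rewrite sumr_const card_ord -(mulr_natr s L.+1).
apply: ler_sum => i _; rewrite /s mulr_suml.
under [leRHS]eq_bigr do rewrite mulr_sumr.
rewrite [leRHS]exchange_big /=; apply: ler_sum => y _.
pose A := \sum_x W x y * r x y; rewrite -/A.
apply: (@le_trans _ _ (\sum_(c : {ffun 'I_L.+1 -> X}) P c * (W (c i) y * (a (c i) y *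
    (1 - \sum_(j | j != i) a (c j) y))))); last first.
  apply: ler_sum => {}c _; do 2 (apply: ler_wpM2l => //).
  by case: (DP c).
pose g x := W x y * a x y.
have Eg : \sum_x p x * g x = A.
  by apply: eq_bigr => x _; rewrite /g mulrCA pa.
rewrite (eq_bigr (fun c : {ffun 'I_L.+1 -> X} => P c * g (c i) -
    \sum_(j | j != i) P c * (g (c i) * a (c j) y))); last first.
  move=> {}c _; rewrite /g -[X in _ = X - _]mulr1 -!mulr_sumr; ring.
rewrite sumrB [X in _ <= _ - X]exchange_big /= expectation1 // Eg.
(* Codewords [i] and [j] are independent, and a random codeword is accepted on [y] with probability
   [1 / M]; the [L] competitors cost [L / M] by a union bound. *)
rewrite [X in _ <= _ - X](eq_bigr (fun=> A * M^-1)) => [|j ji]; last first.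
  have ij : i != j by rewrite eq_sym.
  rewrite [LHS](expectation2 g (a^~ y) ij p1) Eg; congr (_ * _).
  by rewrite -(rM y); apply: eq_bigr => x _; rewrite pa.
rewrite sumr_const (_ : #|_| = L); last first.
  by rewrite cardC1 card_ord.
by rewrite -(mulr_natr _ L) le_eqVlt; apply/orP; left; apply/eqP; rewrite -/A; ring.
Qed.

End RandomCoding.

(** * Block channel laws and error probabilities *)

Section SchemeErrors.
Variable R : realType.
Variables (K : nat) (X : finType) (Y : 'I_K -> finType).
Variable N : X -> joint_out Y -> R.
Hypothesis N_pmf : is_BC N.

Lemma chan_n_pmf n : cond_pmf (chan_n N (n := n)).
Proof.
move=> x; split=> [y|]; first by apply: prodr_ge0 => t _; case: (N_pmf (x t)).
rewrite -(bigA_distr_bigA (fun t b => N (x t) b)) big1 // => t _.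
by case: (N_pmf (x t)).
Qed.

Definition marginal_chan n (k : 'I_K) (x : Xn X n) (z : Ykn Y n k) : R :=
  \sum_(y : Yn Y n | proj_rx y k == z) chan_n N x y.

Lemma sum_marginal_chan n k (x : Xn X n) (g : Ykn Y n k -> R) :
  \sum_z marginal_chan x z * g z = \sum_(y : Yn Y n) chan_n N x y * g (proj_rx y k).
Proof.
rewrite [RHS](partition_big (fun y : Yn Y n => proj_rx y k) xpredT) //=.
apply: eq_bigr => z _; rewrite mulr_suml.
by apply: eq_bigr => y /eqP <-.
Qed.

Lemma sum_msgs_marginal (m : 'I_K -> nat) (k : 'I_K) (g : 'I_(m k) -> R) :
  (forall j, (0 < m j)%N) ->
  (\prod_(i < K) (m i)%:R)^-1 * \sum_(w : msgs m) g (w k) =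
  (m k)%:R^-1 * \sum_i g i.
Proof.
move=> m0; rewrite -prodfV !mulr_sumr.
apply: (@sum_dffun_marginal R _ (fun j => 'I_(m j)) (fun j _ => (m j)%:R^-1)) => j.
by rewrite sumr_const card_ord -[LHS]mulr_natr mulVf // pnatr_eq0 -lt0n.
Qed.

Lemma sum_msgs_const (m : 'I_K -> nat) (k : 'I_K) (c : R) :
  (forall j, (0 < m j)%N) ->
  (\prod_(i < K) (m i)%:R)^-1 * \sum_(w : msgs m) c = c.
Proof.
move=> m0; have E := @sum_msgs_marginal m k (fun=> c) m0.
rewrite [LHS]E sumr_const card_ord -[X in _ * X]mulr_natr mulrCA mulVf ?mulr1 //.
by rewrite pnatr_eq0 -lt0n.
Qed.

(** Given the channel output the decoders act independently, so the guesses of the other receivers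
    sum out. *)
Lemma classical_err n (m : 'I_K -> nat) (S : classical_scheme R X Y n m) k :
  err_prob (classical_law N S) k = (\prod_(i < K) (m i)%:R)^-1 *
  \sum_w \sum_x enc S w x *
     \sum_(y : Yn Y n) chan_n N x y * (1 - dec S (proj_rx y k) (w k)).
Proof.
congr (_ * _); apply: eq_bigr => w _; apply: eq_bigr => x _.
rewrite mulr_sumr; apply: eq_bigr => y _.
rewrite /classical_law -mulr_sumr -mulrA; congr (_ * (_ * _)).
rewrite sum_indicator (@sum_dffun_marginal R _ (fun j => 'I_(m j))
  (fun j i => dec S (proj_rx y j) i) k (fun i => (i != w k)%:R)); last first.
  by move=> j; case: (dec_pmf S (proj_rx y j)).
rewrite -sum_indicator; case: (dec_pmf S (proj_rx y k)) => _ <-.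
by rewrite [X in _ = X - _](bigD1 (w k)) //= addrAC subrr add0r.
Qed.

Lemma max_err_ge0 n (m : 'I_K -> nat) (J : msgs m -> Xn X n -> Yn Y n -> msgs m -> R) :
  0 <= max_err J.
Proof. by rewrite /max_err; elim/big_rec: _ => // i x _ x0; rewrite le_max x0 orbT. Qed.

Lemma err_le_max n (m : 'I_K -> nat) (J : msgs m -> Xn X n -> Yn Y n -> msgs m -> R) k :
  err_prob J k <= max_err J.
Proof. by rewrite /max_err (bigD1 k) //= le_max lexx. Qed.

Lemma max_err_le n (m : 'I_K -> nat) (J : msgs m -> Xn X n -> Yn Y n -> msgs m -> R) e :
  0 <= e -> (forall k, err_prob J k <= e) -> max_err J <= e.
Proof.
by move=> e0 Je; rewrite /max_err; elim/big_ind: _ => // x y x0 y0; rewrite ge_max x0.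
Qed.

End SchemeErrors.

(** * Single-user codes as broadcast schemes *)

Section Rounding.
Variable R : realType.
Variables (K : nat) (X : finType) (Y : 'I_K -> finType).
Variable N : X -> joint_out Y -> R.
Hypothesis N_pmf : is_BC N.
Variable n : nat.

(** The other users have one message each and cannot err; the message of user [k] is uniform, so its
    success probability is the average over the codebook [c]. *)
Lemma single_user_scheme (m : 'I_K -> nat) (k : 'I_K)
    (c : 'I_(m k) -> Xn X n) (D : Ykn Y n k -> 'I_(m k) -> R) :
  (forall j, (0 < m j)%N) -> (forall j, j != k -> m j = 1%N) -> cond_pmf D ->
  exists S : classical_scheme R X Y n m,
    (forall j, j != k -> err_prob (classical_law N S) j = 0) /\
    err_prob (classical_law N S) k = 1 -
      (m k)%:R^-1 * \sum_i \sum_z marginal_chan N (c i) z * D z i.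
Proof.
move=> m0 m1 Dpmf.
pose e (w : msgs m) x : R := (x == c (w k))%:R.
pose d := dfwith (T := fun j => Ykn Y n j -> 'I_(m j) -> R)
  (fun j _ _ => (m j)%:R^-1) k D.
have e_pmf : cond_pmf e.
  move=> w; split=> [x|]; first by rewrite ler0n.
  by rewrite /e (bigD1 (c (w k))) //= eqxx big1 ?addr0 // => x /negPf->.
have dk : d k = D by exact: dfwithin.
have dj j : j != k -> d j = (fun _ _ => (m j)%:R^-1).
  by move=> jk; apply: dfwithout; rewrite eq_sym.
have d_pmf j : @cond_pmf R (Ykn Y n j) 'I_(m j) (d j).
  case: (eqVneq j k) => [->|jk]; first by rewrite dk.
  rewrite dj // => y; split => //.
  by rewrite sumr_const card_ord -[LHS]mulr_natr mulVf // pnatr_eq0 -lt0n.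
exists (ClassicalScheme e_pmf d_pmf); split=> [j jk|].
  rewrite /err_prob [X in _ * X]big1 ?mulr0 // => w _; rewrite big1 // => x _.
  rewrite big1 // => y _; rewrite big_pred0 // => wh; apply/negbTE.
  rewrite negbK; apply/eqP/val_inj.
  case: (wh j) (w j) => [a a1] [b b1] /=; move: a1 b1.
  by rewrite m1 // !ltnS !leqn0 => /eqP-> /eqP->.
rewrite classical_err //=.
under [X in _ * X]eq_bigr => w _.
  under eq_bigr => x _ do rewrite mulrC.
  rewrite -sum_indicator big_pred1_eq dk.
  over.
rewrite (@sum_msgs_marginal R K m k (fun i => \sum_(y : Yn Y n)
  chan_n N (c i) y * (1 - D (proj_rx y k) i))) //.
under [X in _ * X]eq_bigr => i _.
  under eq_bigr => y _ do rewrite mulrBr mulr1.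
  rewrite sumrB (proj2 (chan_n_pmf N_pmf (c i))).
  rewrite -(sum_marginal_chan N (c i) (D^~ i)).
  over.
rewrite sumrB sumr_const card_ord mulrBr mulVf // pnatr_eq0 -lt0n.
exact: m0.
Qed.

End Rounding.

(** * Rounding a non-signaling box to a code for one receiver *)

Section BoxRounding.
Variable R : realType.
Variables (K : nat) (X : finType) (Y : 'I_K -> finType).
Variable N : X -> joint_out Y -> R.
Hypothesis N_pmf : is_BC N.
Variables (n : nat) (m : 'I_K -> nat).
Variable Z : msgs m * rx_in Y n -> Xn X n * msgs m -> R.
Hypothesis Z_box : NS_box Z.
Hypothesis m_gt0 : forall k, (0 < m k)%N.

Lemma box_ge0 a b : 0 <= Z a b.
Proof. by case: Z_box => + _; case/(_ a). Qed.

Lemma sum_fst_eq (F : Xn X n * msgs m -> R) x (Q : pred (msgs m)) :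
  \sum_(b | (b.1 == x) && Q b.2) F b = \sum_(wh | Q wh) F (x, wh).
Proof.
rewrite (reindex_onto (fun wh => (x, wh)) snd) => [|[a b] /= /andP[/eqP-> _] //].
by apply: eq_bigl => wh; rewrite /= !eqxx andbT.
Qed.

(** Non-signaling for the transmitter alone, with [T] empty. *)
Lemma box_tx (w : msgs m) (y y' : rx_in Y n) x :
  \sum_wh Z (w, y) (x, wh) = \sum_wh Z (w, y') (x, wh).
Proof.
have E a : \sum_(b : Xn X n * msgs m | (true ==> (b.1 == x)) &&
    [forall k in finset.set0, b.2 k == w k]) Z a b = \sum_wh Z a (x, wh).
  rewrite -(sum_fst_eq _ x xpredT); apply: eq_bigl => b /=; congr andb.
  by apply/forall_inP => k; rewrite inE.
rewrite -!E; apply: (proj2 Z_box true) => // k; by rewrite inE.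
Qed.

(** Non-signaling for the transmitter together with receiver [k]. *)
Lemma box_tx_rx k (w : msgs m) (y y' : rx_in Y n) x : y k = y' k ->
  \sum_(wh : msgs m | wh k == w k) Z (w, y) (x, wh) =
  \sum_(wh : msgs m | wh k == w k) Z (w, y') (x, wh).
Proof.
move=> yk; have E a : \sum_(b : Xn X n * msgs m | (true ==> (b.1 == x)) &&
    [forall j in [set k]%SET, b.2 j == w j]) Z a b =
    \sum_(wh : msgs m | wh k == w k) Z a (x, wh).
  rewrite -(sum_fst_eq _ x (fun wh : msgs m => wh k == w k)).
  apply: eq_bigl => b /=; congr andb; apply/forall_inP/idP => [|bk j].
    by apply; rewrite inE.
  by rewrite inE => /eqP->.
by rewrite -!E; apply: (proj2 Z_box true) => // j; rewrite inE => /eqP->.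
Qed.

(** Non-signaling for receiver [k] alone: its guess carries no information on the messages. *)
Lemma box_rx k (w w' : msgs m) (y : rx_in Y n) (i : 'I_(m k)) :
  \sum_(b : Xn X n * msgs m | b.2 k == i) Z (w, y) b =
  \sum_(b : Xn X n * msgs m | b.2 k == i) Z (w', y) b.
Proof.
(* [NS_box] is stated for a codeword [x] even when the transmitter is outside the subset; if there
   is none, both sums are empty. *)
have [x _|noX] := pickP (@predT (Xn X n)); last first.
  by rewrite !big_pred0 // => -[x wh]; have := noX x.
pose v : msgs m := [ffun j => dfwith (T := fun j => 'I_(m j)) (fun j => w j) k i j].
have vk : v k = i by rewrite ffunE dfwithin.
have E a : \sum_(b : Xn X n * msgs m | (false ==> (b.1 == x)) &&
    [forall j in [set k]%SET, b.2 j == v j]) Z a b =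
    \sum_(b : Xn X n * msgs m | b.2 k == i) Z a b.
  apply: eq_bigl => b /=; apply/forall_inP/idP => [|bk j].
    by rewrite -vk; apply; rewrite inE.
  by rewrite inE => /eqP->; rewrite vk.
by rewrite -!E; apply: (proj2 Z_box false).
Qed.

Variable y0 : rx_in Y n.

(** The point is that the joint law has mass one although the box is fed the channel output: by
    [box_tx] the law of the codeword can be taken at the fixed input [y0], and then the channel sums
    out. *)
Lemma box_success k :
  (\prod_(i < K) (m i)%:R)^-1 * (\sum_(w : msgs m) \sum_x \sum_(y : Yn Y n)
     \sum_(wh : msgs m | wh k == w k) NS_law N Z w x y wh) =
  1 - err_prob (NS_law N Z) k.
Proof.
apply/eqP; rewrite -subr_eq opprK /err_prob -mulrDr -big_split /=; apply/eqP.
have one w : \sum_x \sum_(y : Yn Y n) \sum_wh NS_law N Z w x y wh = 1.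
  transitivity (\sum_x \sum_wh Z (w, y0) (x, wh)); last first.
    by rewrite pair_bigA -(proj2 (proj1 Z_box (w, y0))); apply: eq_bigr => -[].
  apply: eq_bigr => x _.
  rewrite -[RHS]mulr1 -(proj2 (chan_n_pmf N_pmf x)) mulr_sumr.
  by apply: eq_bigr => y _; rewrite -mulr_suml (box_tx _ _ y0).
rewrite [X in _ * X](eq_bigr (fun=> 1)) => [|w _].
  exact: (sum_msgs_const k).
rewrite -big_split -(one w); apply: eq_bigr => x _ /=; rewrite -big_split.
by apply: eq_bigr => y _ /=; rewrite [RHS](bigID (fun wh : msgs m => wh k == w k)).
Qed.

(** Apply [random_codebook] to the codeword law [p] and to [r x z], the probability that the box
    outputs [x] and a correct guess when receiver [k] sees [z]. *)
Lemma round_box k L : (0 < L)%N ->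
  exists S : classical_scheme R X Y n (fun j => if j == k then L else 1%N),
    max_err (classical_law N S) <= max_err (NS_law N Z) + L.-1%:R / (m k)%:R.
Proof.
move=> L0.
(* The other receivers get the dummy inputs [y0]; by [box_tx_rx] these do not affect the marginal of
   the transmitter and receiver [k]. *)
pose ext (z : Ykn Y n k) : rx_in Y n :=
  [ffun j => dfwith (T := fun j => Ykn Y n j) (fun j => y0 j) k z j].
have extk z : ext z k = z by rewrite ffunE dfwithin.
pose P : R := (\prod_(i < K) (m i)%:R)^-1.
have P0 : 0 <= P by rewrite invr_ge0 prodr_ge0.
pose p x := P * \sum_(w : msgs m) \sum_wh Z (w, y0) (x, wh).
pose r x z := P * \sum_(w : msgs m) \sum_(wh : msgs m | wh k == w k) Z (w, ext z) (x, wh).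
pose w0 : msgs m := [ffun j => Ordinal (m_gt0 j)].
have const (c : R) : P * \sum_(w : msgs m) c = c.
  exact: (sum_msgs_const k).
have p0 x : 0 <= p x.
  by apply: mulr_ge0 => //; do 2 (apply: sumr_ge0 => ? _); apply: box_ge0.
have p1 : \sum_x p x = 1.
  rewrite -mulr_sumr exchange_big /= -[RHS]const; congr (_ * _); apply: eq_bigr => w _.
  by rewrite pair_bigA -(proj2 (proj1 Z_box (w, y0))); apply: eq_bigr => -[].
have rp x z : 0 <= r x z <= p x.
  apply/andP; split.
    by apply: mulr_ge0 => //; do 2 (apply: sumr_ge0 => ? _); apply: box_ge0.
  apply: ler_wpM2l => //; apply: ler_sum => w _; rewrite (box_tx w y0 (ext z)).
  rewrite [leRHS](bigID (fun wh : msgs m => wh k == w k)) /= lerDl.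
  by apply: sumr_ge0 => *; apply: box_ge0.
(* The guess has a law that does not depend on the messages, so it hits the uniform [w k] with
   probability [1 / m k]. *)
have rM z : \sum_x r x z = (m k)%:R^-1.
  rewrite -mulr_sumr exchange_big /=.
  pose g i := \sum_(b : Xn X n * msgs m | b.2 k == i) Z (w0, ext z) b.
  rewrite (eq_bigr (fun w : msgs m => g (w k))) => [|w _]; last first.
    by rewrite /g (box_rx w0 w) pair_big; apply: eq_big => -[].
  rewrite /P sum_msgs_marginal // -[RHS]mulr1; congr (_ * _).
  rewrite -(proj2 (proj1 Z_box (w0, ext z))).
  by rewrite [RHS](partition_big (fun b : Xn X n * msgs m => b.2 k) xpredT).
pose m' j := if j == k then L else 1%N.
have m'k : m' k = L by rewrite /m' eqxx.
have W0 x z : 0 <= marginal_chan N (n := n) (k := k) x z.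
  by apply: sumr_ge0 => y _; case: (chan_n_pmf N_pmf x).
have L0' : (0 < m' k)%N by rewrite m'k.
have [c [D [Dpmf cD]]] := random_codebook L0' W0 p0 p1 rp rM.
have [||//|S [Sj Sk]] := single_user_scheme N_pmf c (D := D).
- by move=> j; rewrite /m'; case: ifP.
- by move=> j /negPf jk; rewrite /m' jk.
have q0 : 0 <= L.-1%:R / (m k)%:R :> R by rewrite divr_ge0.
exists S; apply: max_err_le => [|j]; first by rewrite addr_ge0 // max_err_ge0.
case: (eqVneq j k) => [->|jk]; last by rewrite Sj // addr_ge0 // max_err_ge0.
rewrite Sk; move: cD; pose s := \sum_z \sum_x marginal_chan N x z * r x z.
rewrite -/s; set V := _ * (\sum_i _) => cD.
have sE : s = 1 - err_prob (NS_law N Z) k.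
  rewrite -box_success /s exchange_big /=.
  transitivity (\sum_x P * \sum_(w : msgs m) \sum_(y : Yn Y n)
     \sum_(wh : msgs m | wh k == w k) NS_law N Z w x y wh); last first.
    by rewrite -mulr_sumr exchange_big.
  apply: eq_bigr => x _; rewrite (sum_marginal_chan N x (r x)).
  rewrite exchange_big /= mulr_sumr; apply: eq_bigr => y _.
  rewrite /r mulrCA; congr (_ * _); rewrite mulr_sumr; apply: eq_bigr => w _.
  rewrite /NS_law -mulr_suml mulrC; congr (_ * _).
  by apply: box_tx_rx; rewrite extk ffunE.
have e0 : 0 <= err_prob (NS_law N Z) k.
  apply: mulr_ge0 => //; apply: sumr_ge0 => w _; apply: sumr_ge0 => x _.
  apply: sumr_ge0 => y _; apply: sumr_ge0 => wh _; apply: mulr_ge0.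
    exact: box_ge0.
  by case: (chan_n_pmf N_pmf x).
(* What remains is [(1 - e) (1 - q) >= 1 - e - q]. *)
have := err_le_max (NS_law N Z) k; move: cD; rewrite sE m'k.
set e := err_prob _ _ in e0 *; set q := _ / _ in q0 *.
move: e0 q0; clearbody e q; nra.
Qed.

End BoxRounding.

(** * Counting messages that one receiver can decode *)

Section ListDecoding.
Variable R : realType.

(** Expand the product of [1 + z] over the elements of [T]. *)
Lemma sum_subsets (I : finType) (T : {set I}) (z : R) :
  \sum_(J : {set I} | J \subset T) z ^+ #|J| = (1 + z) ^+ #|T|.
Proof.
pose F i := if i \in T then z else 0.
transitivity (\prod_i (F i + 1)).
  rewrite bigA_distr big_mkcond /=; apply: eq_bigr => J _.
  case: ifPn => [JT|/fintype.subsetPn[i iJ iT]].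
    rewrite -big_mkcond /= -prodr_const; apply: eq_bigr => i iJ.
    by rewrite /F (fintype.subsetP JT).
  by rewrite (bigD1 i) //= iJ /F (negPf iT) mul0r.
rewrite -prodr_const [RHS]big_mkcond; apply: eq_bigr => i _; rewrite /F.
by case: ifP; rewrite ?add0r // addrC.
Qed.

Lemma sum_bool_card (A : finType) (P : pred A) :
  \sum_a (P a)%:R = #|[pred a | P a]|%:R :> R.
Proof.
rewrite -sum1_card natr_sum [RHS]big_mkcond.
by apply: eq_bigr => a _; rewrite inE; case: (P a).
Qed.

Variables (H X B : finType) (f : H -> X -> B) (C : nat).
Hypothesis collide : forall x x', x != x' -> (#|[pred a | f a x == f a x']| <= C)%N.
Hypothesis H_gt0 : (0 < #|H|)%N.

Variable n : nat.
Definition observe (h : {ffun 'I_n -> H}) (x : {ffun 'I_n -> X}) : {ffun 'I_n -> B} :=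
  [ffun t => f (h t) (x t)].

Definition diff_set (x x' : {ffun 'I_n -> X}) : {set 'I_n} := [set t | x t != x' t].

(** Bound on the probability, under a uniform state, that two distinct input symbols give the same
    output. *)
Let u : R := C%:R / #|H|%:R.

(** The count factors over positions: at most [C] states where the words differ, all states where
    they agree. *)
Lemma collision_prob x x' :
  #|[set h | observe h x == observe h x']|%:R <= #|H|%:R ^+ n * u ^+ #|diff_set x x'| :> R.
Proof.
have u0 : 0 <= u by rewrite divr_ge0.
have H0 : #|H|%:R != 0 :> R by rewrite pnatr_eq0 -lt0n.
rewrite -sum1_card natr_sum big_mkcond /=.
pose g t a : R := (f a (x t) == f a (x' t))%:R.
rewrite (eq_bigr (fun h : {ffun 'I_n -> H} => \prod_t g t (h t))); last first.
  move=> h _; rewrite inE; case: eqP => [E|E].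
    rewrite big1 // => t _; rewrite /g; have := congr1 (fun o : {ffun _} => o t) E.
    by rewrite !ffunE => ->; rewrite eqxx.
  have [t ft] : exists t, f (h t) (x t) != f (h t) (x' t).
    apply/existsP; apply: contraT => /existsPn all; case: E.
    by apply/ffunP => t; rewrite !ffunE; apply/eqP; have := all t; rewrite negbK.
  by rewrite (bigD1 t) //= /g (negPf ft) mul0r.
rewrite -(bigA_distr_bigA g).
have -> : #|H|%:R ^+ n * u ^+ #|diff_set x x'| =
    \prod_(t < n) (#|H|%:R * (if t \in diff_set x x' then u else 1)).
  by rewrite big_split /= prodr_const card_ord -prodr_const -[X in _ = _ * X]big_mkcond.
apply: ler_prod => t _; rewrite sumr_ge0 //=.
rewrite /g sum_bool_card inE.
case: eqP => [->|/eqP xx]; first by rewrite mulr1 ler_nat max_card.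
by rewrite /u mulrCA mulfV // mulr1 ler_nat collide.
Qed.

Variables (W L : finType) (lab : W -> L) (code : W -> {ffun 'I_n -> X}).
Variable D : {ffun 'I_n -> H} -> {ffun 'I_n -> B} -> L -> R.
Hypothesis D_pmf : forall h, cond_pmf (D h).

Variables (G : {set W}) (T : {set 'I_n}).
Hypothesis G_agree : forall w w', w \in G -> w' \in G -> diff_set (code w') (code w) \subset T.

(** Messages with equal output and equal label do not compete with each other in the decoder. *)
Definition confusable w h :=
  [set w' in G | (lab w' == lab w) && (observe h (code w') == observe h (code w))].

(** These are left to the remaining receivers to separate. *)
Definition siblings w (T' : {set 'I_n}) :=
  [set w' in G | (lab w' == lab w) && (diff_set (code w') (code w) \subset T')].

(** Exchange the sums, bound each collision count by [collision_prob], and group the messages by the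
    positions where they differ from [w]. *)
Lemma sum_confusable w (b c : R) : w \in G -> 0 <= b ->
  (forall T' : {set 'I_n}, T' \subset T -> #|siblings w T'|%:R <= b * c ^+ #|T'|) ->
  \sum_h #|confusable w h|%:R <= #|H|%:R ^+ n * (b * (1 + u * c) ^+ #|T|).
Proof.
move=> wG b0 sib.
have u0 : 0 <= u by rewrite divr_ge0.
under eq_bigr => h _.
  rewrite -sum1_card natr_sum (eq_bigl (fun w' => ((w' \in G) && (lab w' == lab w)) &&
    (observe h (code w') == observe h (code w)))); last by move=> w'; rewrite inE andbA.
  rewrite big_mkcondr /=.
  over.
rewrite exchange_big /=.
apply: (@le_trans _ _ (\sum_(w' in G | lab w' == lab w)
    #|H|%:R ^+ n * u ^+ #|diff_set (code w') (code w)|)).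
  apply: ler_sum => w' _; apply: le_trans (collision_prob _ _).
  by rewrite -sum1_card natr_sum [leRHS]big_mkcond /= le_eqVlt; apply/orP; left; apply/eqP;
    apply: eq_bigr => h _; rewrite inE.
rewrite -mulr_sumr; apply: ler_wpM2l; first by rewrite exprn_ge0.
(* Replacing the difference set by a sum over all [J] that contain it turns the inner sum into a
   sibling count; [sum_subsets] then sums the powers of [u * c]. *)
apply: (@le_trans _ _ (\sum_(w' in G | lab w' == lab w)
   \sum_(J : {set 'I_n} | J \subset T)
     u ^+ #|J| * (diff_set (code w') (code w) \subset J)%:R)).
  apply: ler_sum => w' /andP[w'G _].
  rewrite (bigD1 (diff_set (code w') (code w))) ?G_agree //= subxx mulr1 lerDl.
  by apply: sumr_ge0 => J _; rewrite mulr_ge0 // exprn_ge0.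
rewrite exchange_big /= -sum_subsets mulr_sumr; apply: ler_sum => J JT.
rewrite -mulr_sumr [in leRHS]exprMn mulrCA; apply: ler_wpM2l; first by rewrite exprn_ge0.
apply: le_trans (sib _ JT).
rewrite -sum1_card natr_sum (eq_bigl (fun w' => ((w' \in G) && (lab w' == lab w)) &&
    (diff_set (code w') (code w) \subset J))); last by move=> w'; rewrite inE andbA.
by rewrite [leRHS]big_mkcondr; apply: ler_sum => w' _; case: ifP.
Qed.

(** Outside [T] all codewords agree, so the output there is determined by [h]. *)
Lemma card_observed h :
  (#|[set observe h (code w) | w in G]| <= #|B| ^ #|T|)%N.
Proof.
have [->|[w0 w0G]] := set_0Vmem G; first by rewrite imset0 cards0.
pose y0 := observe h (code w0).
apply: (@leq_trans #|family (fun t => if t \in T then predT else pred1 (y0 t))|).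
  apply: subset_leq_card; apply/fintype.subsetP => _ /imsetP[w wG ->].
  apply/familyP => t; case: ifPn => // tT; rewrite inE !ffunE.
  apply/eqP; congr f; apply/eqP; apply: contraNT tT => d.
  by apply: (fintype.subsetP (G_agree w0G wG)); rewrite inE.
rewrite card_family foldrE big_map big_enum /= (bigID (mem T)) /=.
rewrite [X in (_ * X)%N]big1 ?muln1 => [|t /negPf->]; last by rewrite card1.
rewrite -prod_nat_const leq_eqVlt; apply/orP; left; apply/eqP.
by apply: eq_bigr => t ->.
Qed.

(** Dividing by the class size counts each pair of output and label once, and for each output the
    decoder has total mass one over the labels. *)
Lemma sum_decoded h :
  \sum_(w in G) D h (observe h (code w)) (lab w) / #|confusable w h|%:R <=
  (#|B| ^ #|T|)%:R.
Proof.
have D0 y l : 0 <= D h y l by case: (D_pmf h y).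
pose key w := (observe h (code w), lab w).
pose O := [set observe h (code w) | w in G].
rewrite (partition_big key (fun yl => yl.1 \in O)) => [|w wG]; last exact: imset_f.
apply: (@le_trans _ _ (\sum_(yl | yl.1 \in O) D h yl.1 yl.2)).
  apply: ler_sum => -[y l] /= _.
  rewrite (eq_bigr (fun=> D h y l / #|[set w in G | key w == (y, l)]|%:R)); last first.
    move=> w /andP[wG /eqP[<- <-]]; congr (_ / _%:R); apply: eq_card => w'.
    by rewrite !inE xpair_eqE [X in _ = _ && X]andbC.
  rewrite sumr_const.
  rewrite -[leLHS]mulr_natr; set k := #|[set w in G | key w == (y, l)]|.
  rewrite (_ : #|_| = k); last by rewrite /k cardsE; apply: eq_card.
  case: (posnP k) => [->|k0]; first by rewrite mulr0.
  by rewrite divfK // pnatr_eq0 -lt0n.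
have <- : \sum_(y in O) \sum_l D h y l = \sum_(yl | yl.1 \in O) D h yl.1 yl.2.
  by rewrite pair_big; apply: eq_bigl => yl; rewrite andbT.
rewrite (eq_bigr (fun=> 1)) => [|y _]; last by case: (D_pmf h y).
by rewrite sumr_const ler_nat card_observed.
Qed.

(** Messages with few confusable ones are limited by the number of outputs ([sum_decoded]), and few
    messages can have many on average ([sum_confusable]); [lam] is the cut between the two. *)
Lemma list_decoding_bound (b c : R) : 0 < b -> 0 <= c ->
  (forall w, w \in G ->
     #|H|%:R ^+ n / 2 <= \sum_h D h (observe h (code w)) (lab w)) ->
  (forall w (T' : {set 'I_n}), w \in G -> T' \subset T ->
     #|siblings w T'|%:R <= b * c ^+ #|T'|) ->
  #|G|%:R <= 16 * b * ((1 + u * c) * #|B|%:R) ^+ #|T|.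
Proof.
move=> b0 c0 good sib.
have u0 : 0 <= u by rewrite divr_ge0.
set Hn := #|H|%:R ^+ n in good.
have Hn0 : 0 < Hn by rewrite exprn_gt0 // ltr0n.
pose beta := b * (1 + u * c) ^+ #|T|.
have beta0 : 0 < beta.
  by rewrite mulr_gt0 // exprn_gt0 // ltr_pwDl // mulr_ge0.
(* With this choice the confusable term costs a quarter of [Hn] per message, against the half that
   [good] provides. *)
pose lam := 4 * beta.
have lam0 : 0 < lam by rewrite mulr_gt0.
(* [D <= lam D / l + l / lam] for a probability [D] and [l > 0]. *)
have key w h : w \in G -> D h (observe h (code w)) (lab w) <=
    lam * (D h (observe h (code w)) (lab w) / #|confusable w h|%:R) +
    #|confusable w h|%:R / lam.
  move=> wG; set d := D _ _ _.
  have d0 : 0 <= d := proj1 (D_pmf h _) _.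
  have d1 : d <= 1.
    case: (D_pmf h (observe h (code w))) => dd <-; rewrite (bigD1 (lab w)) //=.
    by rewrite lerDl sumr_ge0.
  have : (0 < #|confusable w h|)%N.
    by apply/card_gt0P; exists w; rewrite inE wG !eqxx.
  move: #|_| => l l0; have l0' : 0 < l%:R :> R by rewrite ltr0n.
  case: (lerP l%:R lam) => lb.
    apply: (@le_trans _ _ (lam * (d / l%:R))); last by rewrite lerDl divr_ge0 // ltW.
    by rewrite mulrCA ler_peMr // ler_pdivlMr // mul1r.
  apply: le_trans d1 _; apply: (@le_trans _ _ (l%:R / lam)).
    by rewrite ler_pdivlMr // mul1r ltW.
  by rewrite lerDr; apply: mulr_ge0; [exact: ltW | exact: divr_ge0].
have A1 : #|G|%:R * (Hn / 2) <= \sum_(w in G) \sum_h D h (observe h (code w)) (lab w).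
  by rewrite mulrC mulr_natr -sumr_const; apply: ler_sum.
have A2 : \sum_(w in G) \sum_h D h (observe h (code w)) (lab w) <=
    lam * (Hn * (#|B| ^ #|T|)%:R) + #|G|%:R * (Hn / 4).
  apply: (@le_trans _ _ (\sum_(w in G) \sum_h
     (lam * (D h (observe h (code w)) (lab w) / #|confusable w h|%:R) +
      #|confusable w h|%:R / lam))).
    by apply: ler_sum => w wG; apply: ler_sum => h _; apply: key.
  under eq_bigr do rewrite big_split /=.
  rewrite big_split /=; apply: lerD.
    rewrite exchange_big /=.
    under eq_bigr do rewrite -mulr_sumr.
    rewrite -mulr_sumr; apply: ler_wpM2l; first exact: ltW.
    have -> : Hn = #|{ffun 'I_n -> H}|%:R by rewrite card_ffun card_ord natrX.
    rewrite mulrC mulr_natr.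
    by rewrite -sumr_const; apply: ler_sum => h _; apply: sum_decoded.
  rewrite [leRHS]mulrC mulr_natr -sumr_const; apply: ler_sum => w wG.
  rewrite -mulr_suml ler_pdivrMr //.
  apply: le_trans (sum_confusable wG (ltW b0) (fun T' TT => sib w T' wG TT)) _.
  by rewrite -/Hn -/beta /lam; lra.
have A3 := le_trans A1 A2.
have : Hn * (#|G|%:R / 4) <= Hn * (lam * (#|B| ^ #|T|)%:R).
  by move: A3; set g := #|G|%:R; set q := (_ ^ _)%:R; lra.
rewrite ler_pM2l // ler_pdivrMr // => /le_trans; apply.
by rewrite /lam /beta natrX exprMn le_eqVlt; apply/orP; left; apply/eqP; ring.
Qed.

End ListDecoding.

(** * Broadcast channels with a random state known to the receivers *)

Section StateChannel.
Variable R : realType.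
Variables (K : nat) (H X B : finType) (f : 'I_K -> H -> X -> B) (C : nat).
Hypothesis collide : forall k x x', x != x' ->
  (#|[pred a | f k a x == f k a x']| <= C)%N.
Hypothesis H_gt0 : (0 < #|H|)%N.
Hypothesis B_gt0 : (0 < #|B|)%N.

(** The factor per channel use that each receiver adds to the bound on decodable messages. *)
Definition expansion : R := 1 + C%:R / #|H|%:R * #|B|%:R.

Lemma expansion_ge1 : 1 <= expansion.
Proof. by rewrite lerDl mulr_ge0 // divr_ge0. Qed.

Section Messages.
Variables (n : nat) (W : finType) (L : 'I_K -> finType) (lab : forall k, W -> L k).
Variable code : W -> {ffun 'I_n -> X}.
Variable D : forall k, {ffun 'I_n -> H} -> {ffun 'I_n -> B} -> L k -> R.
Hypothesis D_pmf : forall k h, cond_pmf (@D k h).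

(* Induction on the receivers [ks]: the siblings of [w] for the first receiver,
   with positions [T'], differ only on [T'] and are separated by the others. *)
Lemma card_decodable (ks : seq 'I_K) (G : {set W}) (T : {set 'I_n}) :
  (forall w w', w \in G -> w' \in G -> diff_set (code w') (code w) \subset T) ->
  (forall w w', w \in G -> w' \in G -> (forall k, k \in ks -> lab k w = lab k w') ->
     w = w') ->
  (forall k w, k \in ks -> w \in G ->
     #|H|%:R ^+ n / 2 <= \sum_h D h (observe (f k) h (code w)) (lab k w)) ->
  #|G|%:R <= 16 ^+ size ks * (#|B|%:R * expansion ^+ size ks) ^+ #|T|.
Proof.
have B1 : 1 <= #|B|%:R :> R by rewrite ler1n.
have e1 := expansion_ge1.
elim: ks G T => [|k ks IH] G T agree sep good /=.
  (* With no receiver left there are no labels to compare, so [sep] identifies any two elements of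
     [G]. *)
  rewrite expr0 mul1r mulr1; apply: (@le_trans _ _ 1); last exact: exprn_ege1.
  rewrite (ler_nat _ _ 1) leqNgt; apply/negP => /card_gt1P[w [w' [wG w'G]]].
  by rewrite (sep w w') ?eqxx.
have c0 : 0 <= #|B|%:R * expansion ^+ size ks :> R.
  by rewrite mulr_ge0 // exprn_ge0 // (le_trans _ e1).
have b0 : 0 < 16 ^+ size ks :> R by rewrite exprn_gt0.
have := @list_decoding_bound R H X B (f k) C (@collide k) H_gt0 n W (L k) (lab k)
  code (@D k) (@D_pmf k) G T agree _ _ b0 c0.
move=> /(_ (fun w => good k w (mem_head _ _))) Hb.
apply: le_trans (Hb _) _ => [w T' wG TT|].
  apply: IH => [w1 w2|w1 w2|j w1 jks].
  - rewrite !inE => /andP[_ /andP[_ /fintype.subsetP s1]].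
    move=> /andP[_ /andP[_ /fintype.subsetP s2]].
    apply/fintype.subsetP => t; rewrite inE.
    have := s1 t; have := s2 t; rewrite !inE.
    case: eqP => [<-|_ -> //]; case: eqP => [<- _ _|_ _ -> //]; by rewrite eqxx.
  - rewrite !inE => /andP[w1G /andP[/eqP l1 _]] /andP[w2G /andP[/eqP l2 _]] eqks.
    by apply: sep => // j; rewrite inE => /orP[/eqP->|/eqks //]; rewrite l1 l2.
  - by rewrite inE => /andP[w1G _]; apply: good => //; rewrite inE jks orbT.
rewrite exprS; apply: ler_wpM2l; first by rewrite mulr_ge0 // ltW.
have u0 : 0 <= C%:R / #|H|%:R :> R by rewrite divr_ge0.
have E1 : 1 <= expansion ^+ size ks by exact: exprn_ege1.
apply: lerXn2r; rewrite ?nnegrE.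
- by rewrite mulr_ge0 // addr_ge0 // mulr_ge0.
- by rewrite mulr_ge0 // exprn_ge0 // (le_trans _ e1).
rewrite mulrC; apply: ler_wpM2l => //.
(* The lone summand 1 is absorbed because [expansion ^+ size ks] is at least 1. *)
rewrite exprS /expansion -/expansion mulrDl mul1r.
by rewrite mulrA; apply: lerD.
Qed.

End Messages.

Definition state_output (h : H) (x : X) : joint_out (fun _ : 'I_K => (H * B)%type : finType) :=
  [ffun k => (h, f k h x)].

(** One uniform state is shared by all receivers and revealed to them, not to the transmitter; given
    it, the outputs are deterministic. *)
Definition state_channel (x : X)
    (y : joint_out (fun _ : 'I_K => (H * B)%type : finType)) : R :=
  #|H|%:R^-1 * \sum_h (y == state_output h x)%:R.

Lemma state_channel_pmf : is_BC state_channel.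
Proof.
move=> x; split=> [y|]; first by rewrite mulr_ge0 // sumr_ge0.
rewrite -mulr_sumr exchange_big /= (eq_bigr (fun=> 1)) => [|h _].
  by rewrite sumr_const -[X in _ * X]mulr_natr mul1r mulVf // pnatr_eq0 -lt0n.
by rewrite (bigD1 (state_output h x)) //= eqxx big1 ?addr0 // => y /negPf->.
Qed.

Lemma sum_state_chan_n n (x : Xn X n)
    (g : Yn (fun _ : 'I_K => (H * B)%type : finType) n -> R) :
  \sum_y chan_n state_channel x y * g y =
  #|H|%:R ^- n * \sum_(h : {ffun 'I_n -> H}) g [ffun t => state_output (h t) (x t)].
Proof.
have E y : chan_n state_channel x y = #|H|%:R ^- n *
    \sum_(h : {ffun 'I_n -> H}) (y == [ffun t => state_output (h t) (x t)])%:R.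
  rewrite /chan_n /state_channel big_split /= prodr_const card_ord exprVn.
  rewrite bigA_distr_bigA /=; congr (_ * _); apply: eq_bigr => h _.
  case: eqP => [->|ne]; first by rewrite big1 // => t _; rewrite ffunE eqxx.
  have [t yt] : exists t, y t != state_output (h t) (x t).
    apply/existsP; apply: contraT => /existsPn all; case: ne.
    by apply/ffunP => t; rewrite ffunE; apply/eqP; have := all t; rewrite negbK.
  by rewrite (bigD1 t) //= (negPf yt) mul0r.
under eq_bigr => y _ do rewrite E -mulrA mulr_suml.
rewrite -mulr_sumr exchange_big /=; congr (_ * _); apply: eq_bigr => h _.
set y0 := [ffun t => _].
rewrite (bigD1 y0) //= eqxx mul1r big1 ?addr0 // => y /negPf->.
by rewrite mul0r.
Qed.

(** Make the encoder deterministic, keep the messages that every receiver decodes with probability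
    at least one half, and apply [card_decodable] with all receivers and all positions. *)
Lemma classical_messages_bound n (m : 'I_K -> nat)
    (S : classical_scheme R X (fun _ : 'I_K => (H * B)%type : finType) n m) :
  (forall k, (0 < m k)%N) ->
  K%:R * max_err (classical_law state_channel S) <= 4^-1 ->
  \prod_(k < K) (m k)%:R <= 2 * 16 ^+ K * (#|B|%:R * expansion ^+ K) ^+ n.
Proof.
move=> m0 err.
pose e k (w : msgs m) x := \sum_(y : Yn (fun _ : 'I_K => (H * B)%type : finType) n)
  chan_n state_channel x y * (1 - dec S (proj_rx y k) (w k)).
have dec1 k y i : 0 <= dec S (k := k) y i <= 1.
  case: (dec_pmf S (k := k) y) => d0 <-; rewrite d0 (bigD1 i) //= lerDl.
  by rewrite sumr_ge0.
have e0 k w x : 0 <= e k w x.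
  apply: sumr_ge0 => y _; apply: mulr_ge0.
    by case: (chan_n_pmf state_channel_pmf x).
  by rewrite subr_ge0; case/andP: (dec1 k (proj_rx y k) (w k)).
(* For each message, some codeword has total error over the receivers at most the average over the
   encoder. *)
have [code codeP] := choice (fun w : msgs m =>
  exists_le_average (fun x => \sum_k e k w x) (proj1 (enc_pmf S w)) (proj2 (enc_pmf S w))).
pose P : R := \prod_(k < K) (m k)%:R.
have P0 : 0 < P by apply: prodr_gt0 => k _; rewrite ltr0n.
have cardP : #|msgs m|%:R = P.
  have := sum_dffun_prod (fun (k : 'I_K) (_ : 'I_(m k)) => 1 : R).
  rewrite big1_eq sumr_const => ->; apply: eq_bigr => k _.
  by rewrite sumr_const card_ord.
have avg : \sum_w \sum_k e k w (code w) <= P / 4.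
  apply: (@le_trans _ _ (\sum_w \sum_x enc S w x * \sum_k e k w x)).
    by apply: ler_sum => w _; apply: codeP.
  under eq_bigr => w _.
    under eq_bigr => x _ do rewrite mulr_sumr.
    rewrite exchange_big /=.
    over.
  rewrite exchange_big /=.
  rewrite (eq_bigr (fun k => P * err_prob (classical_law state_channel S) k)) => [|k _].
    rewrite -mulr_sumr ler_wpM2l //; first exact: ltW.
    apply: le_trans err.
    apply: (@le_trans _ _ (\sum_(k < K) max_err (classical_law state_channel S))).
      by apply: ler_sum => k _; apply: err_le_max.
    by rewrite sumr_const card_ord -[leLHS]mulr_natr mulrC.
  by rewrite classical_err mulrA mulfV ?mul1r // gt_eqF.
(* Markov's inequality: the total error averages at most 1/4, so at most half of the messages leave
   some receiver with error above 1/2. *)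
pose G := [set w : msgs m | [forall k, e k w (code w) <= 2^-1]].
have cG : P / 2 <= #|G|%:R.
  have : #|~: G|%:R * 2^-1 <= P / 4.
    apply: le_trans avg; rewrite [leRHS](bigID (mem (~: G))) /=.
    apply: (@le_trans _ _ (\sum_(w in ~: G) 2^-1)).
      by rewrite sumr_const -[leRHS]mulr_natr mulrC.
    rewrite -[leLHS]addr0; apply: lerD; last first.
      by apply: sumr_ge0 => w _; apply: sumr_ge0.
    apply: ler_sum => w; rewrite inE inE negb_forall => /existsP[k ek].
    rewrite (bigD1 k) //= -[leLHS]addr0; apply: lerD; last exact: sumr_ge0.
    by rewrite ltW // ltNge.
  have : #|G|%:R + #|~: G|%:R = P by rewrite -natrD cardsC cardP.
  set a := #|G|%:R; set b := #|~: G|%:R; lra.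
(* The states are part of the output, so fixing them leaves a decoder of the symbols [o]. *)
pose D k (h : {ffun 'I_n -> H}) (o : {ffun 'I_n -> B}) i : R :=
  @dec _ _ _ _ _ _ S k [ffun t => (h t, o t)] i.
have Dp k h : cond_pmf (@D k h) by move=> o; apply: dec_pmf.
have := @card_decodable n (msgs m) (fun k => 'I_(m k)) (fun k w => w k) code D Dp
  (enum 'I_K) G finset.setT.
rewrite finset.cardsT card_ord size_enum_ord => bound.
have -> : \prod_(k < K) (m k)%:R = P by [].
have : P / 2 <= 16 ^+ K * (#|B|%:R * expansion ^+ K) ^+ n.
  apply: le_trans cG (bound _ _ _) => [w w' _ _|w w' _ _ eq|k w _].
  - by apply/fintype.subsetP => t; rewrite !inE.
  - by apply/ffunP => k; apply: eq; rewrite mem_enum.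
  rewrite inE => /forallP/(_ k); rewrite /e.
  under eq_bigr do rewrite mulrBr mulr1.
  rewrite sumrB (proj2 (chan_n_pmf state_channel_pmf (code w))).
  rewrite (sum_state_chan_n (code w) (fun y => dec S (proj_rx y k) (w k))).
  have Hn0 : 0 < #|H|%:R ^+ n :> R by rewrite exprn_gt0 // ltr0n.
  rewrite lerBlDr -lerBlDl => le2; rewrite -ler_pdivlMl //.
  suff <- : \sum_(h : {ffun 'I_n -> H})
      dec S (proj_rx [ffun t => state_output (h t) (code w t)] k) (w k) =
    \sum_h D k h (observe (f k) h (code w)) (w k) by lra.
  apply: eq_bigr => h _; rewrite /D; congr (dec S _ _).
  by apply/ffunP => t; rewrite !ffunE.
by rewrite ler_pdivrMr // mulrC mulrA.
Qed.

End StateChannel.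

(** * The polynomial evaluation channel and its perfect non-signaling box *)

Section ReedSolomon.
Variables (K s : nat) (F : finFieldType) (al : 'I_K -> 'I_s -> F).
Hypothesis al_inj : forall k h k' h', al k h = al k' h' -> (k, h) = (k', h').

Definition rs_eval (k : 'I_K) (h : 'I_s) (x : 'rV[F]_K) : F := (rVpoly x).[al k h].

Lemma rs_evalD k h x z : rs_eval k h (x + z) = rs_eval k h x + rs_eval k h z.
Proof. by rewrite /rs_eval linearD hornerD. Qed.

Lemma rs_evalB k h x z : rs_eval k h (x - z) = rs_eval k h x - rs_eval k h z.
Proof. by rewrite /rs_eval linearB hornerD hornerN. Qed.

Lemma rs_roots (x : 'rV[F]_K) (rs : seq F) :
  uniq rs -> all (root (rVpoly x)) rs -> (K <= size rs)%N -> x = 0.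
Proof.
move=> u r leK; apply/eqP; rewrite -[_ == _](inj_eq (can_inj rVpolyK)) linear0.
apply: contraT => p0; have := max_poly_roots p0 r u.
by rewrite ltnNge (leq_trans (size_poly _ _) leK).
Qed.

(** The difference is a nonzero polynomial of degree below [K], and the points of one receiver are
    distinct. *)
Lemma rs_collide k x x' : x != x' ->
  (#|[pred a | rs_eval k a x == rs_eval k a x']| <= K)%N.
Proof.
move=> xx; rewrite leqNgt; apply: contraNN xx => big; rewrite -subr_eq0; apply/eqP.
apply: (@rs_roots _ [seq al k a | a in [pred a | rs_eval k a x == rs_eval k a x']]).
- by rewrite map_inj_uniq ?enum_uniq // => a b E; case: (al_inj E).
- apply/allP => _ /fintype.imageP[a ae ->]; rewrite inE in ae.
  by rewrite rootE -/(rs_eval k a _) rs_evalB subr_eq0.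
- by rewrite size_image ltnW.
Qed.

(** The points [al k (h k)] are distinct, as different receivers have disjoint point sets;
    evaluation at them is an injective map from [F^K] to itself, hence onto. *)
Lemma rs_interpolation (h : 'I_K -> 'I_s) (v : 'I_K -> F) :
  exists x, forall k, rs_eval k (h k) x = v k.
Proof.
pose ev (x : 'rV[F]_K) : 'rV[F]_K := \row_k rs_eval k (h k) x.
have ev_inj : injective ev.
  move=> x x' E; apply/eqP; rewrite -subr_eq0; apply/eqP.
  apply: (@rs_roots _ [seq al k (h k) | k <- enum 'I_K]).
  - by rewrite map_inj_uniq ?enum_uniq // => k k' E'; case: (al_inj E').
  - apply/allP => _ /mapP[k _ ->]; rewrite rootE -/(rs_eval k (h k) _) rs_evalB.
    by have := congr1 (fun A : 'rV_K => A ord0 k) E; rewrite !mxE => ->; rewrite subrr.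
  - by rewrite size_map size_enum_ord.
have [g _ gK] := injF_bij ev_inj.
exists (g (\row_k v k)) => k.
by have := congr1 (fun A : 'rV_K => A ord0 k) (gK (\row_k v k)); rewrite !mxE.
Qed.

Variable R : realType.
Variable n : nat.
Notation Yrs := (fun _ : 'I_K => ('I_s * F)%type : finType).
Notation word := {ffun 'I_n -> F}.
Definition rs_msgs (k : 'I_K) : nat := #|{: word}|.

(* One-time pad: the receiver adds the part of the message that the observed
   symbol does not account for. *)
Definition rs_guess k (i : 'I_(rs_msgs k)) (z : Ykn Yrs n k) (x : Xn 'rV[F]_K n) :
    'I_(rs_msgs k) :=
  enum_rank ([ffun t => (enum_val i : word) t + ((z t).2 - rs_eval k (z t).1 (x t))] : word).

Definition rs_guesses (w : msgs rs_msgs) (y : rx_in Yrs n) (x : Xn 'rV[F]_K n) :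
  msgs rs_msgs := [ffun k => rs_guess (w k) (y k) x].

Definition rs_box (a : msgs rs_msgs * rx_in Yrs n) (b : Xn 'rV[F]_K n * msgs rs_msgs) : R :=
  #|Xn 'rV[F]_K n|%:R^-1 * (b.2 == rs_guesses a.1 a.2 b.1)%:R.

Lemma sum_rs_box a (P : pred (Xn 'rV[F]_K n * msgs rs_msgs)) :
  \sum_(b | P b) rs_box a b =
  #|Xn 'rV[F]_K n|%:R^-1 * \sum_x (P (x, rs_guesses a.1 a.2 x))%:R.
Proof.
rewrite -mulr_sumr; congr (_ * _); rewrite big_mkcond /=.
transitivity (\sum_x \sum_wh
   (if P (x, wh) then (wh == rs_guesses a.1 a.2 x)%:R else 0 : R)).
  by rewrite pair_bigA; apply: eq_bigr => -[].
apply: eq_bigr => x _; rewrite (bigD1 (rs_guesses a.1 a.2 x)) //= eqxx.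
rewrite big1 ?addr0; first by case: ifP.
by move=> wh /negPf->; rewrite if_same.
Qed.

(** If the transmitter is in the subset, [w] is fixed and each guess uses only its own [y k]. If
    not, a translation of the uniform [x] hides the change of messages. *)
Lemma rs_box_NS : NS_box rs_box.
Proof.
split=> [a|].
  split=> [b|]; first by rewrite mulr_ge0 // invr_ge0.
  rewrite sum_rs_box sumr_const -[X in _ * X]mulr_natr mul1r mulVf // pnatr_eq0.
  by rewrite -lt0n; apply/card_gt0P; exists 0.
move=> tx T w w' y y' x wh txw Ty; rewrite !sum_rs_box; congr (_ * _).
case: tx txw => [/(_ isT)<- | _] /=.
  apply: eq_bigr => x' _; congr (_ && _)%:R.
  by apply: eq_forallb_in => k kT; rewrite !ffunE Ty.
(* The translation [z] takes the value [w' k - w k] at the points observed in [y'], which cancels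
   the change of message in every guess. *)
have [z zP] : exists z : Xn 'rV[F]_K n, forall t k,
    rs_eval k (y' k t).1 (z t) = (enum_val (w' k) : word) t - (enum_val (w k) : word) t.
  have [z zP] := choice (fun t => rs_interpolation (fun k => (y' k t).1)
    (fun k => (enum_val (w' k) : word) t - (enum_val (w k) : word) t)).
  by exists [ffun t => z t] => t k; rewrite ffunE zP.
rewrite [RHS](reindex_inj (addIr z)) /=; apply: eq_bigr => x' _; congr (_%:R).
congr nat_of_bool; apply: eq_forallb_in => k kT; rewrite !ffunE Ty //; congr (_ == _).
rewrite /rs_guess; congr enum_rank; apply/ffunP => t; rewrite !ffunE rs_evalD zP.
ring.
Qed.

(** On a genuine channel output the observed symbol equals the evaluation of [x], so the correction
    in the guess vanishes. *)
Lemma rs_box_err k : (0 < s)%N ->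
  err_prob (NS_law (state_channel R rs_eval) rs_box) k = 0.
Proof.
move=> s0; rewrite /err_prob [X in _ * X]big1 ?mulr0 // => w _; apply: big1 => x _.
under eq_bigr => y _ do rewrite /NS_law -mulr_suml mulrC.
rewrite (sum_state_chan_n rs_eval x (fun y =>
  \sum_(wh : msgs rs_msgs | wh k != w k) rs_box (w, all_rx y) (x, wh))).
rewrite big1 ?mulr0 // => h _; apply: big1 => wh /eqP ne; rewrite /rs_box /=.
case: eqP => [E|_]; last by rewrite mulr0.
case: ne; rewrite E ffunE /rs_guess -[RHS]enum_valK; congr enum_rank.
by apply/ffunP => t; rewrite !ffunE /= subrr addr0.
Qed.

End ReedSolomon.

(** * Logarithms and limits of rates *)

Section Rates.
Variable R : realType.
Implicit Types x y : R.

Lemma ln2_gt0 : 0 < ln 2 :> R.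
Proof. by rewrite ln_gt0 // ltr1n. Qed.

Lemma log2M x y : 0 < x -> 0 < y -> log2 (x * y) = log2 x + log2 y.
Proof. by move=> x0 y0; rewrite /log2 lnM ?posrE // mulrDl. Qed.

Lemma log2X n x : 0 < x -> log2 (x ^+ n) = n%:R * log2 x.
Proof. by move=> x0; rewrite /log2 lnXn // mulrA mulr_natl. Qed.

Lemma log2_1 : log2 1 = 0 :> R.
Proof. by rewrite /log2 ln1 mul0r. Qed.

Lemma log2_2 : log2 2 = 1 :> R.
Proof. by rewrite /log2 divff // gt_eqF // ln2_gt0. Qed.

Lemma ler_log2 x y : 0 < x -> x <= y -> log2 x <= log2 y.
Proof.
move=> x0 xy; rewrite /log2 ler_pM2r ?invr_gt0 ?ln2_gt0 //.
by rewrite ler_ln // posrE // (lt_le_trans x0).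
Qed.

Lemma log2_prod (I : finType) (F : I -> R) :
  (forall i, 0 < F i) -> log2 (\prod_i F i) = \sum_i log2 (F i).
Proof.
move=> F0; suff [_ ->] : 0 < \prod_i F i /\ log2 (\prod_i F i) = \sum_i log2 (F i) by [].
elim/big_rec2: _ => [|i y x _ [x0 E]]; first by rewrite ltr01 log2_1.
by rewrite mulr_gt0 // log2M // E.
Qed.

Local Open Scope classical_set_scope.

Lemma cvg_invn : (fun n : nat => n%:R^-1 : R) @ \oo --> (0 : R).
Proof. by rewrite -cvg_shiftS; exact: cvg_harmonic. Qed.

(** Since [ln n = 2 ln (sqrt n) < 2 sqrt n], the quotient is at most a constant over [sqrt n]. *)
Lemma cvg_log2n : (fun n : nat => n%:R^-1 * log2 n%:R : R) @ \oo --> (0 : R).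
Proof.
pose c : R := 2 / ln 2.
apply: (@squeeze_cvgr _ _ _ R (fun=> 0) (fun n => Num.sqrt (n%:R^-1) * c)).
- near=> n; have n0 : (0 < n)%N by near: n; exact: nbhs_infty_gt.
  have n0' : 0 < n%:R :> R by rewrite ltr0n.
  apply/andP; split.
    by rewrite mulr_ge0 // -log2_1 ler_log2 // ler1n.
  rewrite /log2 /c mulrA mulrA ler_pM2r ?invr_gt0 ?ln2_gt0 //.
  rewrite sqrtrV ?ler0n //; set r := Num.sqrt n%:R.
  have r0 : 0 < r by rewrite sqrtr_gt0.
  have -> : n%:R = r * r by rewrite -expr2 sqr_sqrtr // ler0n.
  rewrite lnM ?posrE // invfM -mulrA ler_pM2l ?invr_gt0 //.
  rewrite mulrC ler_pdivrMr // mulrC mulr_natr mulr2n.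
  by rewrite lerD // ltW // ln_sublinear.
- exact: cvg_cst.
- rewrite -[X in _ --> X](mul0r c) -[X in X * c](sqrtr0 R).
  apply: cvgM; last exact: cvg_cst.
  apply: (@cvg_comp _ _ _ (fun n : nat => n%:R^-1 : R) Num.sqrt); first exact: cvg_invn.
  exact: sqrt_continuous.
Unshelve. all: by end_near. Qed.

(** [M / n <= (M %/ n).+1 <= 2 M], so the rate moves by at most [log2 n / n] down or [1 / n] up. *)
Lemma rate_divn (M : nat -> nat) (l : R) : (forall n, (0 < M n)%N) ->
  (fun n : nat => n%:R^-1 * log2 (M n)%:R) @ \oo --> l ->
  (fun n : nat => n%:R^-1 * log2 ((M n %/ n).+1)%:R) @ \oo --> l.
Proof.
move=> M0 Ml.
apply: (@squeeze_cvgr _ _ _ R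
  (fun n => n%:R^-1 * log2 (M n)%:R - n%:R^-1 * log2 n%:R)
  (fun n => n%:R^-1 * log2 (M n)%:R + n%:R^-1)).
- near=> n; have n0 : (0 < n)%N by near: n; exact: nbhs_infty_gt.
  have n0' : 0 < n%:R :> R by rewrite ltr0n.
  rewrite -mulrBr -{5}(mulr1 n%:R^-1) -mulrDr !ler_pM2l ?invr_gt0 //; apply/andP; split.
    rewrite lerBlDr -log2M ?ltr0n // ler_log2 ?ltr0n //.
    by rewrite -natrM ler_nat ltnW // ltn_ceil.
  rewrite -[X in _ <= _ + X]log2_2 -log2M ?ltr0n // ler_log2 ?ltr0n // -natrM ler_nat.
  by rewrite muln2 -addnn -(addn1 (_ %/ _)) leq_add // leq_div.
- rewrite -[X in _ --> X]subr0; apply: cvgB => //; exact: cvg_log2n.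
- rewrite -[X in _ --> X]addr0; apply: cvgD => //; exact: cvg_invn.
Unshelve. all: by end_near. Qed.

End Rates.

(** * The gain is at most the number of users *)

Section UpperBound.
Variable R : realType.
Variables (K : nat) (X : finType) (Y : 'I_K -> finType).
Variable N : X -> joint_out Y -> R.
Hypothesis N_pmf : is_BC N.

Lemma NS_achievable_single (x0 : X) (r : 'I_K -> R) (k : 'I_K) :
  NS_achievable N r -> achievable N (fun j => if j == k then r k else 0).
Proof.
case=> ms [Z [ms0 [Zbox [Zerr Zrate]]]].
(* The channel law at [x0] sums to one, so some joint output exists; it supplies the dummy inputs
   [y0]. *)
have [b0 _] : exists b0 : joint_out Y, true.
  apply: contrapT => none; have /eqP[] := oner_neq0 R.
  by rewrite -(proj2 (N_pmf x0)) big1 // => b; case: none; exists b.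
pose y0 n : rx_in Y n := [ffun k => [ffun t => b0 k]].
(* Then [L n - 1 <= ms n k / n], so rounding adds at most [1 / n] to the error, and by [rate_divn]
   the rate is unchanged in the limit. *)
pose L n := (ms n k %/ n).+1.
pose ms' n (j : 'I_K) := if j == k then L n else 1%N.
have HS n := cid (round_box N_pmf (Zbox n) (ms0 n) (y0 n) k (ltn0Sn (ms n k %/ n))).
exists ms', (fun n => projT1 (HS n)); split; [|split].
- by move=> n j; rewrite /ms'; case: ifP.
- apply: (@squeeze_cvgr _ _ _ R (fun=> 0)
    (fun n => max_err (NS_law N (Z n)) + n%:R^-1)).
  + near=> n; have n0 : (0 < n)%N by near: n; exact: nbhs_infty_gt.
    rewrite max_err_ge0 /=; apply: le_trans (projT2 (HS n)) _.
    rewrite lerD2l /= ler_pdivrMr ?ltr0n ?ms0 // mulrC ler_pdivlMr ?ltr0n //.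
    by rewrite -natrM ler_nat leq_divM.
  + exact: cvg_cst.
  + rewrite -[X in (_ --> X)%classic]addr0; apply: cvgD => //; exact: cvg_invn.
- move=> j; rewrite /ms'; case: eqVneq => _.
    have [l [Ml rl]] := Zrate k; exists l; split => //.
    by apply: (@rate_divn R (fun n => ms n k) l) => // n; apply: ms0.
  exists 0; split => //; rewrite log2_1.
  by under eq_fun do rewrite mulr0; apply: cvg_cst.
Unshelve. all: by end_near. Qed.

Lemma NS_rate_le_sum_capacity (x0 : X) (r : 'I_K -> R) (k : 'I_K) :
  0 <= r k -> NS_achievable N r -> ((r k)%:E <= sum_capacity N)%E.
Proof.
move=> rk Nr; apply: ereal_sup_ubound.
exists (fun j => if j == k then r k else 0); last first.
  by rewrite -big_mkcond big_pred1_eq.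
split=> [j|]; first by case: ifP.
exact: NS_achievable_single.
Qed.

Lemma NS_ratio_le (hK : (0 < K)%N) : (0 < sum_capacity N)%E ->
  (NS_sum_capacity N / sum_capacity N <= K%:R%:E)%E.
Proof.
move=> C0.
(* Positive capacity yields a sequence of schemes; the encoder at block length 1 has mass one, so a
   word of length 1, hence an input symbol, exists. *)
have [x0 _] : exists x0 : X, true.
  have [_ [r [_ [ms [S [ms0 _]]]] _] _] := ereal_sup_gt C0.
  apply: contrapT => none; have /eqP[] := oner_neq0 R.
  pose w : msgs (ms 1%N) := [ffun j => Ordinal (ms0 1%N j)].
  rewrite -(proj2 (enc_pmf (S 1%N) w)) big1 // => x.
  by case: none; exists (x ord0).
have rateC r k := @NS_rate_le_sum_capacity x0 r k.
(* If the classical capacity is infinite, its inverse is zero and so is the ratio. *)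
case: (sum_capacity N) C0 rateC => [c||] //= C0 rateC; last first.
  by rewrite invey mule0 lee_fin.
rewrite lte_fin in C0.
rewrite inver gt_eqF // lee_pdivrMr // -EFinM.
apply: ge_ereal_sup => _ [r [r0 Nr] <-]; rewrite lee_fin.
rewrite mulr_natl -[X in _ *+ X]card_ord -sumr_const; apply: ler_sum => k _.
by have := rateC r k (r0 k) Nr; rewrite lee_fin.
Qed.

End UpperBound.

(** * Capacities of the polynomial evaluation channel *)

Section ReedSolomonCapacity.
Variable R : realType.
Variables (K s : nat) (F : finFieldType) (al : 'I_K -> 'I_s -> F).
Hypothesis al_inj : forall k h k' h', al k h = al k' h' -> (k, h) = (k', h').
Hypothesis s_gt0 : (0 < s)%N.

Let N := @state_channel R K _ _ _ (rs_eval al).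
Let q : R := #|F|%:R.

Lemma card_finField_gt1 : 1 < q.
Proof.
have : (1 < #|F|)%N by apply/card_gt1P; exists 0, 1; rewrite !inE eq_sym oner_neq0.
by rewrite -(ltr_nat R).
Qed.

Lemma rs_NS_achievable : NS_achievable N (fun=> log2 q).
Proof.
exists (fun n => @rs_msgs K F n), (fun n => @rs_box K s F al R n); split; [|split; [|split]].
- by move=> n k; apply/card_gt0P; exists 0.
- by move=> n; exact: rs_box_NS.
- have E n : max_err (NS_law N (@rs_box K s F al R n)) = 0.
    apply/eqP; rewrite eq_le max_err_ge0 andbT; apply: max_err_le => // k.
    by rewrite rs_box_err.
  by under eq_fun do rewrite E; apply: cvg_cst.
- move=> k; exists (log2 q); split => //.
  (* At [n = 0] the rate is zero by the convention for [0^-1], so the equality holds only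
     eventually. *)
  apply: cvg_near_cst; near=> n; have n0 : (0 < n)%N by near: n; exact: nbhs_infty_gt.
  have q1 := card_finField_gt1.
  rewrite /rs_msgs card_ffun card_ord natrX log2X ?(lt_trans ltr01) //.
  by rewrite mulKf // pnatr_eq0 -lt0n.
Unshelve. all: by end_near. Qed.

Lemma rs_sum_capacity_le :
  (sum_capacity N <= (log2 (q * expansion R 'I_s F K ^+ K))%:E)%E.
Proof.
apply: ge_ereal_sup => _ [r [r0 [ms [S [ms0 [err rate]]]]] <-]; rewrite lee_fin.
have [l lP] := choice rate; have q1 := card_finField_gt1.
apply: (@le_trans _ _ (\sum_k l k)); first by apply: ler_sum => k _; case: (lP k).
set E := q * _; set B : R := 2 * 16 ^+ K.
have E0 : 0 < E.
  apply: mulr_gt0; first exact: lt_trans ltr01 q1.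
  by apply: exprn_gt0; apply: lt_le_trans ltr01 (expansion_ge1 _ _ _ _).
have B0 : 0 < B by apply: mulr_gt0 => //; apply: exprn_gt0.
(* An error below this threshold gives [K * max_err <= 1/4], as [classical_messages_bound]
   requires. *)
have K1 : 0 < 4^-1 / (K%:R + 1) :> R by rewrite divr_gt0 // ltr_wpDl.
apply: (@ler_cvg_to _ \oo%classic _ R (fun n : nat => \sum_k n%:R^-1 * log2 (ms n k)%:R)
  (fun n => n%:R^-1 * log2 B + log2 E)).
- apply: cvg_big => [|k _]; first exact: add_continuous.
  by case: (lP k).
- rewrite -[X in (_ --> X)%classic]add0r -[X in (_ --> X + _)%classic](mul0r (log2 B)).
  apply: cvgD; last exact: cvg_cst.
  by apply: cvgM; [exact: cvg_invn|exact: cvg_cst].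
near=> n; have n0 : (0 < n)%N by near: n; exact: nbhs_infty_gt.
have n0' : 0 < n%:R :> R by rewrite ltr0n.
rewrite -mulr_sumr -log2_prod => [|k]; last by rewrite ltr0n.
have -> : n%:R^-1 * log2 B + log2 E = n%:R^-1 * log2 (B * E ^+ n).
  rewrite log2M // ?exprn_gt0 // log2X // mulrDr mulKf //.
  by rewrite gt_eqF.
rewrite ler_pM2l ?invr_gt0 // ler_log2 //.
  by apply: prodr_gt0 => k _; rewrite ltr0n.
apply: (classical_messages_bound (rs_collide al_inj)) => //.
- by rewrite card_ord.
- by apply/card_gt0P; exists 0.
- have : max_err (classical_law N (S n)) < 4^-1 / (K%:R + 1).
    near: n; exact: (cvgr_lt _ err).
  rewrite ltr_pdivlMr ?ltr_wpDl // mulrDr mulr1 => lt.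
  by have := max_err_ge0 (classical_law N (S n)); rewrite mulrC; lra.
Unshelve. all: by end_near. Qed.

Lemma rs_gain_ratio (hK : (0 < K)%N) :
  exists2 z, @NS_gain_ratios R K z &
    ((K%:R * log2 q / log2 (q * expansion R 'I_s F K ^+ K))%:E <= z)%E.
Proof.
have q1 := card_finField_gt1; have s0' : (0 < #|'I_s|)%N by rewrite card_ord.
have N_pmf : is_BC N by exact: state_channel_pmf.
have lq0 : 0 < log2 q by rewrite /log2 divr_gt0 ?ln2_gt0 // ln_gt0.
have up := rs_sum_capacity_le; set d := log2 (q * _) in up *.
(* The rounding argument also shows that the classical sum-capacity is at least [log2 q], hence
   positive. *)
have lo := NS_rate_le_sum_capacity N_pmf 0 (k := Ordinal hK) (ltW lq0) rs_NS_achievable.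
have NSlo : ((K%:R * log2 q)%:E <= NS_sum_capacity N)%E.
  apply: ereal_sup_ubound; exists (fun=> log2 q); last first.
    by rewrite sumr_const card_ord mulr_natl.
  by split=> [_|]; [exact: ltW|exact: rs_NS_achievable].
have C0 : (0 < sum_capacity N)%E by rewrite (lt_le_trans _ lo) // lte_fin.
exists (NS_sum_capacity N / sum_capacity N)%E.
  by exists 'rV[F]_K, (fun=> ('I_s * F)%type : finType), N.
case: (sum_capacity N) C0 up => [c||] //; rewrite lte_fin lee_fin => c0 cd.
rewrite inver gt_eqF // lee_pdivlMr // (le_trans _ NSlo) // -EFinM lee_fin.
have d0 := lt_le_trans c0 cd.
rewrite mulrAC ler_pdivrMr // ler_wpM2l // mulr_ge0 // ltW //.
Qed.

End ReedSolomonCapacity.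

(** * Large prime fields and the supremum *)

(** Cut the prime field into [K] disjoint blocks of size [s = p %/ K]. Then [p <= 2 s K], so
    [expansion], which is [1 + K p / s], stays below a bound that depends on [K] only. *)
Lemma gain_ratio_prime (R : realType) (K p : nat) :
  (0 < K)%N -> prime p -> (K <= p)%N ->
  exists2 z, @NS_gain_ratios R K z &
    ((K%:R * log2 p%:R / (log2 p%:R + K%:R * log2 (1 + 2 * K%:R ^+ 2)))%:E <= z)%E.
Proof.
move=> K0 pp Kp; pose s := (p %/ K)%N.
have s0 : (0 < s)%N by rewrite divn_gt0.
have cF : #|'F_p| = p by rewrite card_Fp.
have lt (k : 'I_K) (h : 'I_s) : (k * s + h < #|'F_p|)%N.
  rewrite cF; apply: (@leq_trans (k.+1 * s)%N); first by rewrite mulSn addnC ltn_add2r.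
  by apply: leq_trans (leq_divM p K); rewrite mulnC leq_mul2l ltn_ord orbT.
pose al k h : 'F_p := enum_val (Ordinal (lt k h)).
have al_inj k h k' h' : al k h = al k' h' -> (k, h) = (k', h').
  move/enum_val_inj => /(congr1 (@nat_of_ord _)) /= E.
  have Ek : k = k' :> nat.
    by have := congr1 (fun i => i %/ s)%N E; rewrite !divnMDl // !divn_small // !addn0.
  have Eh : h = h' :> nat by move: E; rewrite Ek => /addnI.
  by congr (_, _); apply: val_inj.
have [z zR zge] := rs_gain_ratio R al_inj s0 K0.
exists z => //; apply: le_trans zge; rewrite lee_fin cF.
have p1 : 1 < p%:R :> R by rewrite ltr1n prime_gt1.
have p0 : 0 < p%:R :> R := lt_trans ltr01 p1.
have lp0 : 0 < log2 p%:R :> R by rewrite /log2 divr_gt0 ?ln2_gt0 // ln_gt0.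
have e1 := @expansion_ge1 R 'I_s 'F_p K.
have e0 : 0 < expansion R 'I_s 'F_p K := lt_le_trans ltr01 e1.
have ee : expansion R 'I_s 'F_p K <= 1 + 2 * K%:R ^+ 2.
  rewrite /expansion card_ord cF lerD2l mulrAC ler_pdivrMr ?ltr0n //.
  rewrite -natrX -!natrM ler_nat.
  have lt2 : (p <= 2 * s * K)%N.
    apply: ltnW; apply: leq_trans (ltn_ceil p K0) _.
    by rewrite leq_mul2r mul2n -addnn -(addn1 s) leq_add2l s0 orbT.
  apply: leq_trans (leq_mul (leqnn K) lt2) _.
  by rewrite leq_eqVlt; apply/orP; left; apply/eqP; rewrite /= expnS expn1; ring.
rewrite log2M ?exprn_gt0 // log2X //.
have l0 : 0 <= log2 (expansion R 'I_s 'F_p K) by rewrite -log2_1 ler_log2.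
have l1 : log2 (expansion R 'I_s 'F_p K) <= log2 (1 + 2 * K%:R ^+ 2) by apply: ler_log2.
have den0 (a : R) : 0 <= a -> 0 < log2 p%:R + K%:R * a.
  by move=> a0; rewrite ltr_wpDr // mulr_ge0.
have l2 := le_trans l0 l1.
apply: ler_wpM2l; first by rewrite mulr_ge0 // ltW.
by rewrite lef_pV2 ?posrE ?den0 // lerD2l ler_wpM2l.
Qed.

Theorem theorem7 (R : realType) (K : nat) (hK : (0 < K)%N) :
  ereal_sup (@NS_gain_ratios R K) = (K%:R : R)%:E.
Proof.
apply/eqP; rewrite eq_le; apply/andP; split.
  by apply: ge_ereal_sup => _ [X [Y [N [N_pmf [C0 ->]]]]]; apply: NS_ratio_le.
apply/lee_subgt0Pr => e e0.
pose E : R := K%:R * log2 (1 + 2 * K%:R ^+ 2).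
have E0 : 0 <= E by rewrite mulr_ge0 // -log2_1 ler_log2 // lerDl mulr_ge0.
(* For [p] above [2 ^ T], [log2 p] exceeds [K E / e], which makes [K log2 p / (log2 p + E)] at least
   [K - e]. *)
pose T := Num.bound (K%:R * E / e).
have [p mp pp] := prime_above (maxn K (2 ^ T)).
have Kp : (K <= p)%N by apply: leq_trans (ltnW mp); apply: leq_maxl.
have [z zR zge] := gain_ratio_prime R hK pp Kp.
apply: le_trans (ereal_sup_ubound zR); apply: le_trans zge; rewrite -EFinB lee_fin -/E.
have Tp : T%:R <= log2 p%:R :> R.
  have -> : T%:R = log2 (2 ^+ T) :> R by rewrite log2X // log2_2 mulr1.
  rewrite ler_log2 ?exprn_gt0 // -natrX ler_nat.
  by apply: leq_trans (ltnW mp); apply: leq_maxr.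
have TE : K%:R * E / e < T%:R.
  by apply: archi_boundP; apply: divr_ge0; [exact: mulr_ge0 | exact: ltW].
have lE : K%:R * E <= log2 p%:R * e.
  by rewrite -ler_pdivrMr // ltW //; apply: lt_le_trans TE Tp.
have lp0 : 0 < log2 p%:R :> R.
  by rewrite /log2 divr_gt0 ?ln2_gt0 // ln_gt0 // ltr1n prime_gt1.
rewrite ler_pdivlMr ?ltr_wpDr //.
have : 0 <= e * E by apply: mulr_ge0; [exact: ltW|].
by move: lE; lra.
Qed.
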